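(* Let $D=(V\cup\{s\},E)$ be a directed graph, let $c:E\to\mathbb{R}_+$ be a nonnegative capacity vector, and let $s$ be a source node with no incoming edges, i.e. $\delta^-(s)=\emptyset$. Assume that for all $\emptyset\ne S\subseteq V$ we have $$c(\delta^-(S))\ge \max\{1,\ c(\delta^+(S))\}.$$ Consider a set $T\subseteq V$ such that there exists a flow $f\le c$ of value $c(\delta^+(s))$ from the source $s$ to the sink set $T$, and $T$ is minimal subject to this property (that is, for every proper subset $T'\subsetneq T$ the maximum flow value from $s$ to $T'$ under capacities $c$ is smaller than $c(\delta^+(s))$). Then $|T|\le 8\,c(\delta^+(s))$.
   Context: For $S\subseteq V\cup\{s\}$, $\delta^+(S)$ (resp. $\delta^-(S)$) is the set of edges of $D$ leaving (resp. entering) $S$, and $c(F)=\sum_{e\in F}c(e)$ for an edge set $F$. A flow from $s$ to a sink set $T$ is a vector $f\in\mathbb{R}^E_{\ge 0}$ satisfying flow conservation $f(\delta^-(v))=f(\delta^+(v))$ at every vertex $v\in V\setminus T$; its value is $f(\delta^+(s))$. *)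

(* Defs.v *)
From mathcomp Require Import all_boot all_order all_algebra.
From mathcomp Require Import reals.

Set Implicit Arguments.
Unset Strict Implicit.
Unset Printing Implicit Defensive.

Import Order.TTheory GRing.Theory Num.Theory.
Local Open Scope ring_scope.

(* Finite directed multigraphs; simple digraphs are the case where
   e |-> (tail e, head e) is injective. *)
Record digraph (W : finType) := Digraph {
  edge : finType;
  tail : edge -> W;
  head : edge -> W
}.

Section Digraph.
Variables (W : finType) (D : digraph W).

Definition dplus (S : {set W}) : {set edge D} :=
  [set e | (tail e \in S) && (head e \notin S)].

Definition dminus (S : {set W}) : {set edge D} :=
  [set e | (tail e \notin S) && (head e \in S)].

Variable R : realType.

Definition weight (g : edge D -> R) (F : {set edge D}) : R :=
  \sum_(e in F) g e.

(* No condition is imposed at the vertices of T, nor at s. *)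
Definition is_flow (s : W) (T : {set W}) (f : edge D -> R) : Prop :=
  (forall e, 0 <= f e) /\
  (forall v, v != s -> v \notin T ->
     weight f (dminus [set v]) = weight f (dplus [set v])).

Definition flow_value (s : W) (f : edge D -> R) : R :=
  weight f (dplus [set s]).

Definition has_saturating_flow (c : edge D -> R) (s : W) (T : {set W}) : Prop :=
  exists f : edge D -> R,
    [/\ is_flow s T f,
        forall e, f e <= c e &
        flow_value s f = weight c (dplus [set s])].

(* Every f <= c has value at most c(delta^+(s)), so a sink set T' fails
   has_saturating_flow exactly when all flows f <= c to T' have value strictly
   below c(delta^+(s)). *)
Definition is_minimal_saturated_sink_set
    (c : edge D -> R) (s : W) (T : {set W}) : Prop :=
  has_saturating_flow c s T /\
  (forall T' : {set W}, T' \proper T -> ~ has_saturating_flow c s T').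

End Digraph.

(* Main.v *)
(* Write F = c(delta^+(s)), in(S) and out(S) for the capacities of delta^-(S)
   and delta^+(S), and g(S) = out(S) - c(s -> S).  By max-flow min-cut a set T'
   admits a saturating flow iff g >= 0 on all S contained in V and disjoint from
   T', so minimality of T provides sets X_t that meet T exactly in t and have
   g(X_t) < 0.  Let L_i be the set of vertices lying in more than i of the X_t;
   for i >= 1 it avoids T, so g(L_i) >= 0.  The private parts
   X'_t = X_t minus L_1 are disjoint and contain t, so
   |T| <= sum_t in(X'_t).  As in(S) - out(S) <= F for every S contained in V
   (apply the cut condition to the complement of S), it remains to check, edge by
   edge, that
     sum_t in(X'_t) - sum_t g(X_t) + sum_{i >= 2} g(L_i)
       + (F - in(L_0) + out(L_0)) <= 2 F.
   This gives |T| <= 2 F, which is stronger than the claim. *)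
Require Import Defs.
From mathcomp Require Import all_boot all_order all_algebra.
From mathcomp Require Import reals zify lra.

Set Implicit Arguments.
Unset Strict Implicit.
Unset Printing Implicit Defensive.

Import Defs Order.TTheory GRing.Theory Num.Theory.
Local Open Scope ring_scope.

(** * Weights of edge sets, and a Hoffman-type feasibility theorem over a lattice family of vertex
    sets *)

Section Weight.
Variables (W : finType) (D : digraph W) (R : realType).
Implicit Types (F : {set edge D}) (S : {set W}) (g : edge D -> R).

Lemma weightE g F : weight g F = \sum_e g e * (e \in F)%:R.
Proof.
rewrite /weight big_mkcond; apply: eq_bigr => e _.
by case: (e \in F); rewrite ?mulr1 ?mulr0.
Qed.

Lemma weight0 g : weight g set0 = 0.
Proof. by rewrite /weight big_set0. Qed.

Definition upd g (e0 : edge D) (x : R) := fun e => if e == e0 then x else g e.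

Lemma weight_upd g e0 x F :
  weight (upd g e0 x) F = weight g F + (x - g e0) * (e0 \in F)%:R.
Proof.
rewrite !weightE (bigD1 e0) //= [in RHS](bigD1 e0) //= /upd eqxx.
rewrite (eq_bigr (fun e => g e * (e \in F)%:R)) => [|e /negPf -> //].
by lra.
Qed.

(* The uncrossing gains u - l on every edge joining A :\: B and B :\: A. *)
Lemma uncross_edge (l u : edge D -> R) (A B : {set W}) e0 :
  (forall e, l e <= u e) -> e0 \in dplus D A -> e0 \in dminus D B ->
  weight u (dplus D (A :&: B)) - weight l (dminus D (A :&: B)) +
  (weight u (dplus D (A :|: B)) - weight l (dminus D (A :|: B))) +
  (u e0 - l e0) <=
  weight u (dplus D A) - weight l (dminus D A) +
  (weight u (dplus D B) - weight l (dminus D B)).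
Proof.
move=> le_lu e0A e0B.
have -> : u e0 - l e0 = \sum_e (u e - l e) * (e == e0)%:R.
  rewrite (bigD1 e0) //= eqxx mulr1 big1 ?addr0 // => e /negPf ->.
  by rewrite mulr0.
rewrite !weightE -!sumrB -!big_split /=; apply: ler_sum => e _.
move: (le_lu e) e0A e0B; rewrite !inE.
by case: (e =P e0) => [->|_ + _ _]; case: (tail _ \in A);
  case: (tail _ \in B); case: (head _ \in A);
  case: (head _ \in B) => //=; lra.
Qed.

(* Fix the value of one edge at a time, at its largest lower bound over P. *)
Lemma hoffman (P : pred {set W}) (l u : edge D -> R) :
  (forall A B, P A -> P B -> P (A :&: B) && P (A :|: B)) ->
  (forall e, l e <= u e) ->
  (forall S, P S -> weight l (dminus D S) <= weight u (dplus D S)) ->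
  exists f : edge D -> R, (forall e, l e <= f e <= u e) /\
    (forall S, P S -> weight f (dminus D S) <= weight f (dplus D S)).
Proof.
move=> lattP.
have [n] := ubnP #|[set e | l e != u e]|.
elim: n l u => // n IHn l u card_lu le_lu cutP.
have [|[e0]] := set_0Vmem [set e | l e != u e].
  move/setP => eq_lu; exists l; split=> [e|S PS]; first by rewrite lexx le_lu.
  suff luE F : weight l F = weight u F by rewrite [leRHS]luE cutP.
  by apply: eq_bigr => e _; move: (eq_lu e); rewrite !inE => /negbFE/eqP.
rewrite inE => lu_e0.
(* With every other edge at its most favourable bound, a set [S] that [e0] leaves forces the value
   of [e0] to be at least [lo S]. *)
pose lo S := weight l (dminus D S) - weight u (dplus D S) + u e0.
pose x := \big[Order.max/l e0]_(S | P S && (e0 \in dplus D S)) lo S.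
have x_ge_l : l e0 <= x by exact: bigmax_ge_id.
have x_le_u : x <= u e0.
  apply/bigmax_leP; split=> [|S /andP[PS _]]; first exact: le_lu.
  by have := cutP S PS; rewrite /lo; lra.
have x_ge_lo S : P S -> e0 \in dplus D S -> lo S <= x.
  by move=> PS eS; apply: le_bigmax_cond; rewrite PS.
have x_le_hi S : P S -> e0 \in dminus D S ->
    x <= weight u (dplus D S) - weight l (dminus D S) + l e0.
  move=> PS eS; apply/bigmax_leP; split=> [|A /andP[PA eA]].
    by have := cutP S PS; lra.
  (* A lower bound from [A] never exceeds an upper bound from [S]: uncross the two and use the cut
     conditions of their intersection and union. *)
  have /andP[PI PU] := lattP _ _ PA PS.
  have := uncross_edge le_lu eA eS; have := cutP _ PI; have := cutP _ PU.
  by rewrite /lo; lra.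
have [||S PS|f [lfu fP]] := IHn (upd l e0 x) (upd u e0 x).
- rewrite (leq_ltn_trans (n := #|[set e | l e != u e] :\ e0|)) //.
    apply: subset_leq_card; apply/subsetP => e; rewrite !inE /upd.
    by case: (e == e0); rewrite ?eqxx.
  by move: card_lu; rewrite (cardsD1 e0) inE lu_e0.
- by move=> e; rewrite /upd; case: ifP.
- rewrite !weight_upd; have := cutP S PS.
  have := x_ge_lo S PS; have := x_le_hi S PS; rewrite /lo !inE.
  case: (tail e0 \in S); case: (head e0 \in S) => /= hi lw cS.
  + lra.
  + by have := lw isT; lra.
  + by have := hi isT; lra.
  + lra.
exists f; split=> // e; have := lfu e; rewrite /upd.
case: (e =P e0) => [-> /andP[h1 h2]|_ //].
by rewrite (le_trans x_ge_l h1) (le_trans h2 x_le_u).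
Qed.

End Weight.

(** * Saturating flows and cuts: both directions of max-flow min-cut *)

Section SaturatingFlow.
Variables (W : finType) (D : digraph W) (R : realType) (s : W).
Variable c : edge D -> R.
Hypothesis c_ge0 : forall e, 0 <= c e.
Hypothesis s_source : dminus D [set s] = set0.

Definition from_source (S : {set W}) : {set edge D} :=
  [set e | (tail e == s) && (head e \in S)].

Lemma head_source (e : edge D) : head e = s -> tail e = s.
Proof.
move=> hs; have := in_set0 e; rewrite -s_source !inE hs eqxx andbT.
by move/negbFE/eqP.
Qed.

(** Saturation forces [f = c] on the edges leaving [s], and conservation inside [S] sends whatever
    enters [S] out again. *)
Lemma saturating_flow_cut (T S : {set W}) :
  has_saturating_flow c s T -> s \notin S -> [disjoint S & T] ->
  weight c (from_source S) <= weight c (dplus D S).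
Proof.
case=> f [[f_ge0 fcons] f_le_c satf] sS dST.
have fc e : e \in dplus D [set s] -> f e = c e.
  move=> eS; apply/eqP; rewrite -subr_eq0 -oppr_eq0 opprB.
  have /psumr_eq0P -> // : \sum_(e' in dplus D [set s]) (c e' - f e') = 0.
    by rewrite sumrB -[X in X - _]satf subrr.
  by move=> e' _; rewrite subr_ge0.
have netf : weight f (dminus D S) = weight f (dplus D S).
  have netE : weight f (dminus D S) - weight f (dplus D S) =
      \sum_(v in S) (weight f (dminus D [set v]) - weight f (dplus D [set v])).
    rewrite !weightE -sumrB (eq_bigr (fun v => \sum_e
      (f e * (e \in dminus D [set v])%:R - f e * (e \in dplus D [set v])%:R)));
      last by move=> v _; rewrite !weightE sumrB.
    rewrite exchange_big /=; apply: eq_bigr => e _.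
    have sum1 w : \sum_(v in S) (w == v)%:R = (w \in S)%:R :> R.
      case: (boolP (w \in S)) => wS.
        rewrite (bigD1 w) //= eqxx big1 ?addr0 // => v /andP[_].
        by rewrite eq_sym => /negPf ->.
      by rewrite big1 // => v vS; case: eqP => // wv; rewrite wv vS in wS.
    transitivity (f e * ((head e \in S)%:R - (tail e \in S)%:R)).
      by rewrite !inE; case: (head e \in S); case: (tail e \in S) => /=; lra.
    rewrite -!sum1 -sumrB mulr_sumr; apply: eq_bigr => v _.
    by rewrite !inE; case: (head e == v); case: (tail e == v) => /=; lra.
  apply/eqP; rewrite -subr_eq0 netE big1 // => v vS.
  rewrite fcons ?subrr //; first by apply: contraNneq sS => <-.
  by rewrite (disjointFr dST vS).
have -> : weight c (from_source S) = weight f (from_source S).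
  apply: eq_bigr => e; rewrite inE => /andP[/eqP te hS].
  rewrite fc // !inE te eqxx /=; by apply: contraNneq sS => <-.
have le1 : weight f (from_source S) <= weight f (dminus D S).
  rewrite !weightE; apply: ler_sum => e _; apply: ler_wpM2l => //.
  rewrite ler_nat !inE; case: eqP => //= ->; by rewrite (negPf sS).
apply: (le_trans le1); rewrite netf; exact: ler_sum.
Qed.

Lemma no_saturating_flow_cut (T : {set W}) :
  ~ has_saturating_flow c s T ->
  exists S : {set W}, [/\ s \notin S, [disjoint S & T] &
    weight c (dplus D S) < weight c (from_source S)].
Proof.
move=> noflow.
have [/existsP[S /and3P[]]|] := boolP [exists S : {set W},
    [&& s \notin S, [disjoint S & T] &
        weight c (dplus D S) < weight c (from_source S)]]; first by exists S.
rewrite negb_exists => /forallP cutT; case: noflow.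
pose B := s |: T.
(* Singletons off [B] and their complements both satisfy [P], so the inequalities on [P] yield
   conservation. The lower bound [l] equals [c] on edges out of [s], which yields saturation. *)
pose P (S : {set W}) := (B \subset S) || [disjoint S & B].
pose l e := c e * (tail e == s)%:R.
have l_ge0 e : 0 <= l e by rewrite /l mulr_ge0.
have [|||f [lfc fP]] := @hoffman _ D R P l c.
- move=> A A' /orP[bA|dA] /orP[bA'|dA'].
  + by rewrite /P subsetI bA bA' (subset_trans bA (subsetUl _ _)).
  + by rewrite /P (subset_trans bA (subsetUl _ _)) andbT
      (disjointWl (subsetIr _ _) dA') orbT.
  + by rewrite /P (subset_trans bA' (subsetUr _ _)) andbT
      (disjointWl (subsetIl _ _) dA) orbT.
  + rewrite /P (disjointWl (subsetIl _ _) dA) disjoints_subset subUset.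
    by rewrite -!disjoints_subset dA dA' !orbT.
- by move=> e; rewrite /l; have := c_ge0 e; case: eqP => _ /=; lra.
(* Only edges out of [s] can have a positive lower bound, and none of them enters a set containing
   [B]; sets disjoint from [B] are handled by [cutT]. *)
- move=> S /orP[bS|dS].
    rewrite {1}/weight big1; first by apply: sumr_ge0.
    move=> e; rewrite inE /l => /andP[tS _]; case: eqP => [te|]; last first.
      by rewrite mulr0.
    by move: tS; rewrite te (subsetP bS) // !inE eqxx.
  have := cutT S.
  have sS : s \notin S by rewrite (disjointFl dS) // !inE eqxx.
  rewrite sS (disjointWr _ dS) ?subsetUr //= -leNgt.
  apply: le_trans; rewrite !weightE; apply: ler_sum => e _; rewrite /l !inE.
  by rewrite -mulrA -natrM mulnb ler_wpM2l // ler_nat;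
    case: eqP => //=; case: (tail e \in S); case: (head e \in S).
exists f; split=> [|e|].
- split=> [e|v vs vT]; first by have /andP[h _] := lfc e; exact: le_trans h.
  have vB : v \notin B by rewrite !inE negb_or vs.
  apply/eqP; rewrite eq_le fP /=; last first.
    by rewrite /P disjoints1 vB orbT.
  have compl S : dplus D (~: S) = dminus D S.
    by apply/setP => e; rewrite !inE negbK.
  have := fP (~: [set v]); rewrite -{1}[[set v]]setCK -!compl !setCK; apply.
  by rewrite /P subsetC sub1set inE vB.
- by have /andP[] := lfc e.
apply: eq_bigr => e; rewrite !inE => /andP[/eqP te _].
apply/eqP; rewrite eq_le; have /andP[h ->] := lfc e.
by move: h; rewrite /l te eqxx mulr1.
Qed.

End SaturatingFlow.

(** * Counting, for each edge, its incidences with the sets [X t] and their levels *)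

Lemma sum_between (n a b : nat) :
  (\sum_(i < n) (b <= i < a)%N)%N = (minn a n - b)%N.
Proof.
elim: n => [|n IHn]; first by rewrite big_ord0; lia.
by rewrite big_ord_recr /= IHn; lia.
Qed.

Section Multiplicity.
Variables (W : finType) (D : digraph W) (s : W) (T : {set W}).
Variable X : W -> {set W}.
Hypothesis s_source : dminus D [set s] = set0.
Hypothesis sX : forall t, s \notin X t.

Definition multiplicity (v : W) : nat := (\sum_(t in T) (v \in X t))%N.

Definition level (i : nat) : {set W} := [set v | (i < multiplicity v)%N].

Definition private_part (t : W) : {set W} := X t :&: ~: level 1.

Lemma multiplicity_le v : (multiplicity v <= #|T|)%N.
Proof. by rewrite -sum1_card; apply: leq_sum => t _; case: (v \in X t). Qed.

Lemma multiplicity_source : multiplicity s = 0%N.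
Proof. by apply: big1 => t _; rewrite (negPf (sX t)). Qed.

(** The indices [i] that count form an interval, and [#|T|] levels suffice since no multiplicity
    exceeds [#|T|]. *)
Lemma sum_dplus_level (e : edge D) :
  (\sum_(i < #|T|) (e \in dplus D (level i.+2)))%N =
  ((multiplicity (tail e)).-2 - (multiplicity (head e)).-2)%N.
Proof.
have := multiplicity_le (tail e); move=> le_aT.
transitivity (minn (multiplicity (tail e)).-2 #|T|
              - (multiplicity (head e)).-2)%N; last by lia.
by rewrite -sum_between; apply: eq_bigr => i _; rewrite !inE; congr nat_of_bool; lia.
Qed.

Lemma sum_source_level (e : edge D) :
  (\sum_(i < #|T|) (e \in from_source D s (level i.+2)))%N =
  ((tail e == s) * (multiplicity (head e)).-2)%N.
Proof.
case: (boolP (tail e == s)) => te; last first.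
  by rewrite big1 // => i _; rewrite inE (negPf te).
have := multiplicity_le (head e); move=> le_bT.
transitivity (minn (multiplicity (head e)).-2 #|T| - 0)%N; last by lia.
by rewrite -sum_between; apply: eq_bigr => i _; rewrite !inE te;
  congr nat_of_bool; lia.
Qed.

Lemma sum_source_X (e : edge D) :
  (\sum_(t in T) (e \in from_source D s (X t)))%N =
  ((tail e == s) * multiplicity (head e))%N.
Proof.
case: (boolP (tail e == s)) => te.
  by rewrite mul1n; apply: eq_bigr => t _; rewrite inE te.
by rewrite big1 // => i _; rewrite inE (negPf te).
Qed.

Lemma multiplicity_dplus (e : edge D) :
  (multiplicity (tail e) <=
   \sum_(t in T) (e \in dplus D (X t)) + multiplicity (head e))%N.
Proof.
rewrite -big_split /=; apply: leq_sum => t _; rewrite inE.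
by case: (tail e \in X t); case: (head e \in X t).
Qed.

(** For [t] in [T], a vertex of [private_part t] lies in no other [X t'], so [e] enters at most one
    private part. *)
Lemma private_dminus_le (e : edge D) :
  (\sum_(t in T) (e \in dminus D (private_part t)) <=
   (multiplicity (head e) == 1))%N.
Proof.
case: (boolP (multiplicity (head e) == 1)%N) => b1; last first.
  rewrite big1 // => t tT; rewrite !inE.
  case: (boolP (head e \in X t)) => hX /=; last by rewrite andbF.
  suff : (0 < multiplicity (head e))%N by lia.
  by rewrite /multiplicity (bigD1 t) //= hX.
apply: leq_trans (eq_leq (eqP b1)); apply: leq_sum => t _; rewrite !inE.
by case: (head e \in X t); rewrite ?leq_b1 ?andbF.
Qed.

(** A tail of multiplicity at most one that lies in [X t] is in [private_part t], so an edge
    entering that part starts outside [X t]. This settles edges with both ends of multiplicity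
    one. *)
Lemma private_dminus_balance (e : edge D) :
  (multiplicity (tail e) <= 1)%N ->
  (\sum_(t in T) (e \in dminus D (private_part t)) + multiplicity (tail e) <=
   \sum_(t in T) (e \in dplus D (X t)) + multiplicity (head e))%N.
Proof.
move=> a1; rewrite -!big_split /=; apply: leq_sum => t _; rewrite !inE.
rewrite [(1 < multiplicity (tail e))%N]ltnNge a1 /=.
by case: (head e \in X t); case: (tail e \in X t) => //; case: ltnP.
Qed.

(* Submodularity of out(X) - c(s -> X) over the family X t, replaced by its
   levels, tested edge by edge: the slack left by the levels of index at least
   2 pays for the edges entering the private parts. *)
Lemma edge_certificate (e : edge D) :
  (\sum_(t in T) (e \in dminus D (private_part t))
   + \sum_(t in T) (e \in from_source D s (X t))
   + \sum_(i < #|T|) (e \in dplus D (level i.+2))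
   + (e \in dplus D [set s]) + (e \in dplus D (level 0))
   <= 2 * (e \in dplus D [set s])
   + \sum_(t in T) (e \in dplus D (X t))
   + \sum_(i < #|T|) (e \in from_source D s (level i.+2))
   + (e \in dminus D (level 0)))%N.
Proof.
rewrite sum_source_X sum_dplus_level sum_source_level.
have := multiplicity_dplus e; have := private_dminus_le e.
have := @private_dminus_balance e.
move: (\sum_(t in T) _)%N (\sum_(t in T) _)%N => q m bal le_q le_m.
have := @head_source _ D s s_source e; have := multiplicity_source.
rewrite !inE; move: bal le_q le_m.
have [->|ts] := eqVneq (tail e) s; have [->|hs] := eqVneq (head e) s => /=.
- by move=> ? ? ? -> _; rewrite ?eqxx /=; lia.
(* The factor [2] is spent here: if the head has multiplicity [b >= 2], both sides equal [b + 1]. *)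
- move=> bal le_q le_m ms _; move: bal le_q le_m; rewrite ms.
  by move: (multiplicity _); lia.
- by move=> ? ? ? _ /(_ erefl) te; rewrite te eqxx in ts.
- move=> bal le_q le_m _ _; move: bal le_q le_m.
  by move: (multiplicity _) (multiplicity _); lia.
Qed.

End Multiplicity.

(* The vertex type W is V together with s, so V is [set~ s]. *)
Theorem theorem3 (R : realType) (W : finType) (D : digraph W) (s : W)
    (c : edge D -> R)
    (c_ge0 : forall e, 0 <= c e)
    (s_source : dminus D [set s] = set0)
    (cut : forall S : {set W}, S != set0 -> S \subset [set~ s] ->
       Num.max 1 (weight c (dplus D S)) <= weight c (dminus D S))
    (T : {set W}) (T_sub : T \subset [set~ s])
    (T_min : is_minimal_saturated_sink_set c s T) :
  #|T|%:R <= 8 * weight c (dplus D [set s]).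
Proof.
have F_ge0 : 0 <= weight c (dplus D [set s]) by apply: sumr_ge0.
have [sat minT] := T_min.
have tight t : t \in T -> exists S : {set W},
    [/\ s \notin S, [disjoint S & T :\ t] &
        weight c (dplus D S) < weight c (from_source D s S)].
  by move=> tT; apply: no_saturating_flow_cut => //; apply/minT/properD1.
have [X XP] : exists X : W -> {set W}, forall t, s \notin X t /\ (t \in T ->
    [/\ t \in X t, [disjoint X t & T :\ t] &
        weight c (dplus D (X t)) <= weight c (from_source D s (X t))]).
  apply: (@fin_all_exists W (fun=> {set W}) (fun t S => s \notin S /\ (t \in T ->
    [/\ t \in S, [disjoint S & T :\ t] &
        weight c (dplus D S) <= weight c (from_source D s S)]))) => t.
  case: (boolP (t \in T)) => tT; last by exists set0; rewrite inE.
  have [S [sS dS ltS]] := tight t tT; exists S; split=> // _.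
  split=> //; last exact: ltW.
  (* If [t] were outside [S], then [S] would avoid all of [T], and the saturating flow to [T] would
     force the reverse inequality. *)
  apply/negPn/negP => tS; move: ltS; rewrite ltNge => /negP; apply.
  apply: (saturating_flow_cut sat) => //.
  rewrite disjoint_subset; apply/subsetP => v vS; rewrite !inE.
  apply/negP => vT; have := disjointFr dS vS; rewrite !inE vT andbT.
  by move/negbFE/eqP => vt; rewrite -vt vS in tS.
have sX t : s \notin X t by case: (XP t).
pose L := level T X.
have sL i : s \notin L i by rewrite inE multiplicity_source.
have mult_T v : v \in T -> multiplicity T X v = 1%N.
  move=> vT; rewrite /multiplicity (bigD1 v) //= big1 => [|t /andP[tT tv]].
    by have [_ /(_ vT) [-> _ _]] := XP v.
  have [_ /(_ tT) [_ dX _]] := XP t.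
  by rewrite (disjointFl dX) // !inE vT eq_sym tv.
have levels i : weight c (from_source D s (L i.+2)) <= weight c (dplus D (L i.+2)).
  apply: (saturating_flow_cut sat) => //.
  rewrite disjoint_subset; apply/subsetP => v; rewrite !inE.
  by apply: contraTN => /mult_T ->.
have private t : t \in T -> 1 <= weight c (dminus D (private_part T X t)).
  move=> tT; have [_ /(_ tT) [tX _ _]] := XP t.
  apply: le_trans (cut _ _ _); first by rewrite le_max lexx.
    by apply/set0Pn; exists t; rewrite !inE tX mult_T.
  by rewrite subsetC sub1set !inE (negPf (sX t)).
have union_excess : weight c (dminus D (L 0)) <=
    weight c (dplus D [set s]) + weight c (dplus D (L 0)).
  pose C := ~: (s |: L 0).
  have cutC : weight c (dplus D C) <= weight c (dminus D C).
    have [->|C0] := eqVneq C set0.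
      have -> : dplus D set0 = set0 by apply/setP => e; rewrite !inE.
      by rewrite weight0 sumr_ge0.
    apply: le_trans (cut C C0 _); first by rewrite le_max lexx orbT.
    by rewrite subsetC sub1set !inE eqxx.
  (* An edge out of [s] enters at most one of [L 0] and [C]; an edge between these two enters one
     and leaves the other. *)
  suff : weight c (dminus D (L 0)) + weight c (dminus D C) <=
      weight c (dplus D [set s]) + weight c (dplus D (L 0))
      + weight c (dplus D C) by lra.
  rewrite !weightE -!big_split /=; apply: ler_sum => e _.
  rewrite -!mulrDr ler_wpM2l // -!natrD ler_nat.
  have := @head_source _ D s s_source e; have := sL 0%N.
  rewrite /C; move: (L 0) => L0.
  rewrite !inE; case: (eqVneq (tail e) s) => [->|ts];
    case: (eqVneq (head e) s) => [->|hs] /negPf s_out hs'; rewrite ?s_out //=.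
  - by case: (head e \in L0).
  - by rewrite (hs' erefl) eqxx in ts.
  - by case: (head e \in L0); case: (tail e \in L0).
have certificate :
  \sum_(t in T) weight c (dminus D (private_part T X t))
  + \sum_(t in T) weight c (from_source D s (X t))
  + \sum_(i < #|T|) weight c (dplus D (L i.+2))
  + weight c (dplus D [set s]) + weight c (dplus D (L 0))
  <= 2 * weight c (dplus D [set s])
  + \sum_(t in T) weight c (dplus D (X t))
  + \sum_(i < #|T|) weight c (from_source D s (L i.+2))
  + weight c (dminus D (L 0)).
  have sumE (I : finType) (P : pred I) (F : I -> {set edge D}) :
      \sum_(i | P i) weight c (F i) =
      \sum_e c e * (\sum_(i | P i) (e \in F i))%N%:R.
    under eq_bigr do rewrite weightE.
    by rewrite exchange_big /=; apply: eq_bigr => e' _; rewrite -mulr_sumr natr_sum.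
  rewrite !sumE !weightE mulr_sumr -!big_split /=; apply: ler_sum => e _.
  rewrite [2 * _]mulrCA -natrM -!mulrDr ler_wpM2l // -!natrD ler_nat.
  exact: edge_certificate.
have : #|T|%:R <= \sum_(t in T) weight c (dminus D (private_part T X t)).
  by rewrite -sum1_card natr_sum; apply: ler_sum.
have : \sum_(t in T) weight c (dplus D (X t)) <=
    \sum_(t in T) weight c (from_source D s (X t)).
  by apply: ler_sum => t tT; have [_ /(_ tT) []] := XP t.
have : \sum_(i < #|T|) weight c (from_source D s (L i.+2)) <=
    \sum_(i < #|T|) weight c (dplus D (L i.+2)) by apply: ler_sum.
(* These bounds give [#|T| <= 2 F] with [F] the capacity out of [s]; [F_ge0] relaxes it to [8 F]. *)
by lra.
Qed.
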